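(* Let $\Omega$ be an open set in $\mathbb R^n$, $n\ge2$, and let $\phi:\Omega\to\mathbb R$ with $\phi\in W^{1,n}_{loc}(\Omega)$. If $e^{\phi}$ is Lipschitz on $\Omega$, then $e^{\phi}$ is nowhere zero on $\Omega$.
   Context: Convention: Sobolev functions are defined up to sets of measure zero. That $e^\phi$ is Lipschitz on $\Omega$ means that it agrees a.e. on $\Omega$ with a Lipschitz function $u:\Omega\to\mathbb R$ (there is a constant $C$ with $|u(y)-u(x)|\le C|y-x|$ for all $x,y\in\Omega$); $e^\phi$ is identified with this unique continuous representative $u$, and the conclusion is that $u(x)\ne0$ for every $x\in\Omega$. *)

(* Defs.v *)
From HB Require Import structures.
From mathcomp Require Import all_boot all_order all_algebra.
From mathcomp Require Import all_classical all_reals all_analysis.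
From mathcomp Require Import lra.

Set Implicit Arguments.
Unset Strict Implicit.
Unset Printing Implicit Defensive.

Import Order.TTheory GRing.Theory Num.Theory.
Import numFieldNormedType.Exports.

Local Open Scope classical_set_scope.
Local Open Scope ring_scope.

(* The Borel sigma-algebra of R^n, presented as the product sigma-algebra
   (see [open_measurable_rV]). *)
Section borel_rV.
Context {R : realType} (n : nat).

Let coord (i : 'I_n) (x : 'rV[R]_n) : measurableTypeR R := x 0 i.

Let rV_set0 : g_sigma_preimage coord set0.
Proof. exact: sigma_algebra0. Qed.

Let rV_setC A : g_sigma_preimage coord A -> g_sigma_preimage coord (~` A).
Proof. exact: sigma_algebraC. Qed.

Let rV_bigcup (F : _^nat) : (forall i, g_sigma_preimage coord (F i)) ->
  g_sigma_preimage coord (\bigcup_i (F i)).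
Proof. exact: sigma_algebra_bigcup. Qed.

HB.instance Definition _ := @isMeasurable.Build default_measure_display
  'rV[R]_n (g_sigma_preimage coord) rV_set0 rV_setC rV_bigcup.

Lemma measurable_coord (i : 'I_n) :
  measurable_fun [set: 'rV[R]_n] (fun x : 'rV[R]_n => x 0 i).
Proof.
move=> _ Y mY; rewrite setTI; apply: sub_sigma_algebra => /=.
rewrite -bigcup_seq/=; exists i => /=; first by rewrite mem_index_enum.
by exists Y => //; rewrite setTI.
Qed.

Lemma measurable_fun_rV d (T : measurableType d) (f : T -> 'rV[R]_n) :
  (forall i, measurable_fun [set: T] (fun t => f t 0 i)) ->
  measurable_fun [set: T] f.
Proof.
move=> mf _ A mA; rewrite setTI.
suff: g_sigma_preimage coord `<=` [set B | measurable (f @^-1` B)] by exact.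
apply: smallest_sub.
  split => /=.
  - by rewrite preimage_set0.
  - by move=> B mB; rewrite setTD -preimage_setC; exact: measurableC.
  - by move=> F mF; rewrite preimage_bigcup; exact: bigcup_measurable.
rewrite -bigcup_seq => B [i _ [Y mY <-]] /=.
by rewrite setTI -comp_preimage -[X in measurable X]setTI; exact: mf.
Qed.

End borel_rV.

Lemma open_measurable_rV (R : realType) (n : nat) (A : set 'rV[R]_n) :
  open A -> measurable A.
Proof.
move=> oA.
pose box (p : {ffun 'I_n -> rat * rat}) : set 'rV[R]_n :=
  [set x | forall i, x 0 i \in `]ratr (p i).1, ratr (p i).2[ ].
have mbox p : measurable (box p).
  have -> : box p = \bigcap_(i in [set: 'I_n])
      ((fun x : 'rV[R]_n => x 0 i) @^-1` `]ratr (p i).1, ratr (p i).2[%classic).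
    by apply/seteqP; split => x /= h i; [move=> _|]; exact: h.
  apply: fin_bigcap_measurable => // i _; rewrite -[X in measurable X]setTI.
  by apply: measurable_coord => //; exact: measurable_itv.
have -> : A = \bigcup_(p in [set p | box p `<=` A]) box p.
  apply/seteqP; split => [x Ax|x [p /= pA]]; last exact: pA.
  have /nbhs_ballP[e /= e0 eA] : nbhs x A by exact: open_nbhs_nbhs.
  have H (i : 'I_n) : exists q : rat * rat,
      [&& x 0 i - e < ratr q.1, ratr q.1 < x 0 i, x 0 i < ratr q.2
        & ratr q.2 < x 0 i + e].
    have [q1 /andP[]] : exists q, ratr q \in `]x 0 i - e, x 0 i[.
      by apply: rat_in_itvoo; rewrite ltrBlDr ltrDl.
    move=> h1 h2.
    have [q2 /andP[]] : exists q, ratr q \in `]x 0 i, x 0 i + e[.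
      by apply: rat_in_itvoo; rewrite ltrDl.
    move=> h3 h4.
    by exists (q1, q2); apply/and4P; split.
  have [q Hq] := choice H.
  exists [ffun i => q i] => /=; last first.
    by move=> i; rewrite ffunE in_itv/=; case/and4P: (Hq i) => _ -> ->.
  move=> y yb; apply: eA; split => // j i; rewrite ord1.
  move: (yb i); rewrite ffunE in_itv/= => /andP[h1 h2].
  case/and4P: (Hq i) => g1 g2 g3 g4.
  rewrite /ball/= ltr_distl; apply/andP; split; lra.
rewrite bigcup_mkcond; apply: countable_bigcupT_measurable.
  exact: countableP.
by move=> p; case: ifP.
Qed.

Section lebesgue_rV.
Context {R : realType}.

Definition row_cons (n : nat) (p : measurableTypeR R * 'rV[R]_n) : 'rV[R]_n.+1 :=
  row_mx (const_mx p.1 : 'rV_1) p.2.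

Lemma row_cons0 n p : @row_cons n p 0 ord0 = p.1.
Proof.
have -> : (ord0 : 'I_n.+1) = lshift n (ord0 : 'I_1) by exact/val_inj.
by have := row_mxEl (const_mx p.1 : 'rV_1) p.2 0 ord0; rewrite [RHS]mxE.
Qed.

Lemma row_consS n p i : @row_cons n p 0 (lift ord0 i) = p.2 0 i.
Proof.
have -> : lift ord0 i = rshift 1 i by exact/val_inj.
exact: row_mxEr.
Qed.

Lemma measurable_row_cons n : measurable_fun [set: _] (@row_cons n).
Proof.
apply: measurable_fun_rV => i; case: (unliftP ord0 i) => [j|] ->.
- under eq_fun do rewrite row_consS.
  exact: (measurableT_comp (measurable_coord j)).
- under eq_fun do rewrite row_cons0.
  exact: measurable_fst.
Qed.

Section row_cons_measure.
Variables (n : nat) (m : {sigma_finite_measure set 'rV[R]_n -> \bar R}).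
Local Open Scope ereal_scope.

Definition row_cons_measure : set 'rV[R]_n.+1 -> \bar R :=
  pushforward (@lebesgue_measure R \x m) (@row_cons n).

Let row_cons_measure0 : row_cons_measure set0 = 0.
Proof. by rewrite /row_cons_measure /pushforward preimage_set0 measure0. Qed.

Let row_cons_measure_ge0 A : 0 <= row_cons_measure A.
Proof. by apply: measure_ge0; exact: measurable_row_cons. Qed.

Let row_cons_measure_sigma_additive : semi_sigma_additive row_cons_measure.
Proof. by apply: measure_semi_sigma_additive; exact: measurable_row_cons. Qed.

HB.instance Definition _ := isMeasure.Build _ _ _ row_cons_measure
  row_cons_measure0 row_cons_measure_ge0 row_cons_measure_sigma_additive.

Let row_cons_measure_sigma_finite : sigma_finite setT row_cons_measure.
Proof.
have [F FT Foo] : sigma_finite setT (@lebesgue_measure R \x m).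
  have /sigma_finiteP[F [TF ndF Foo]] := sigma_finiteT (@lebesgue_measure R).
  have /sigma_finiteP[G [TG ndG Goo]] := sigma_finiteT m.
  exists (fun k => F k `*` G k).
    rewrite -setXTT TF TG predeqE => -[x y]; split.
      move=> [/= [k _ Fkx] [l _ Gly]]; exists (maxn k l) => //; split.
      - by move: x Fkx; exact/subsetPset/ndF/leq_maxl.
      - by move: y Gly; exact/subsetPset/ndG/leq_maxr.
    by move=> [k _ []/= ? ?]; split; exists k.
  move=> k; have [? ?] := Foo k; have [? ?] := Goo k.
  split; first exact: measurableX.
  by rewrite product_measure1E// lte_mul_pinfty// ge0_fin_numE.
pose split (x : 'rV[R]_n.+1) : measurableTypeR R * 'rV[R]_n :=
  (x ord0 ord0, \row_i x ord0 (lift ord0 i)).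
have splitK : cancel (@row_cons n) split.
  move=> [x y]; rewrite /split row_cons0; congr pair.
  by apply/rowP => i; rewrite mxE row_consS.
have msplit : measurable_fun setT split.
  apply/measurable_fun_pairP; split; first exact: measurable_coord.
  apply: measurable_fun_rV => i /=; under eq_fun do rewrite mxE.
  exact: measurable_coord.
exists (fun k => split @^-1` F k).
  by rewrite -preimage_bigcup -FT preimage_setT.
move=> k; have [mF Fk] := Foo k; split.
  by rewrite -[X in measurable X]setTI; exact: msplit.
rewrite /row_cons_measure /pushforward -comp_preimage.
by rewrite (_ : split \o _ = id) ?preimage_id//; exact/funext.
Qed.

HB.instance Definition _ := Measure_isSigmaFinite.Build _ _ _ row_cons_measure
  row_cons_measure_sigma_finite.

End row_cons_measure.

(* Lebesgue measure on R^n, as the n-fold product of the one on R. *)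
Fixpoint lebesgue_rV (n : nat) : {sigma_finite_measure set 'rV[R]_n -> \bar R} :=
  match n with
  | 0 => \d_(0 : 'rV[R]_0)
  | m.+1 => row_cons_measure (lebesgue_rV m)
  end.

Lemma lebesgue_rV_box n (a b : 'rV[R]_n) : (forall i, a 0 i <= b 0 i) ->
  lebesgue_rV n [set x | forall i, x 0 i \in `[a 0 i, b 0 i]] =
  (\prod_(i < n) (b 0 i - a 0 i))%:E.
Proof.
elim: n a b => [|n IHn] a b ab.
  by rewrite big_ord0 /= diracE mem_set//= => -[].
rewrite big_ord_recl /= /row_cons_measure /pushforward.
pose a' := \row_i a 0 (lift ord0 i); pose b' := \row_i b 0 (lift ord0 i).
have mbox : measurable [set x : 'rV[R]_n | forall i, x 0 i \in `[a' 0 i, b' 0 i]].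
  rewrite (_ : mkset _ = \bigcap_(i in [set: 'I_n])
    ((fun x : 'rV[R]_n => x 0 i) @^-1` `[a' 0 i, b' 0 i]%classic)); last first.
    by apply/seteqP; split => x /= h i; [move=> _|]; exact: h.
  apply: fin_bigcap_measurable => // i _; rewrite -[X in measurable X]setTI.
  by apply: measurable_coord => //; exact: measurable_itv.
rewrite (_ : _ @^-1` _ = `[a 0 ord0, b 0 ord0]%classic `*`
    [set x : 'rV[R]_n | forall i, x 0 i \in `[a' 0 i, b' 0 i]]); last first.
  apply/seteqP; split=> -[x y] /=.
    move=> h; split; first by have := h ord0; rewrite row_cons0.
    by move=> i; have := h (lift ord0 i); rewrite row_consS !mxE.
  move=> [hx hy] i; case: (unliftP ord0 i) => [j|] ->; last by rewrite row_cons0.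
  by rewrite row_consS; have := hy j; rewrite !mxE.
rewrite product_measure1E//.
rewrite IHn => [|i]; last by rewrite !mxE.
rewrite EFinM; congr (_ * _)%E; last first.
  by congr EFin; apply: eq_bigr => i _; rewrite !mxE.
transitivity (lebesgue_measure `[a 0 ord0, b 0 ord0]%classic) => //.
rewrite lebesgue_measure_itv/= lte_fin.
have := ab ord0; rewrite le_eqVlt => /predU1P[->|->]//.
by rewrite ltxx subrr.
Qed.

End lebesgue_rV.

(* A function on [Omega] is represented by a total function, whose values
   outside [Omega] are irrelevant; test functions are extended by zero. *)
Section sobolev.
Context {R : realType} (n : nat).
Implicit Types (Omega : set 'rV[R]_n) (f g : 'rV[R]_n -> R).

Definition basis_rV (i : 'I_n) : 'rV[R]_n := delta_mx 0 i.

(* The norm [`|x|] that the library puts on 'rV[R]_n is the sup norm. *)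
Definition enorm (x : 'rV[R]_n) : R := Num.sqrt (\sum_(i < n) x 0 i ^+ 2).

Definition lipschitz_fun Omega f : Prop :=
  exists C : R, forall x y, Omega x -> Omega y ->
    `|f y - f x| <= C * enorm (y - x).

Fixpoint Ck (k : nat) f : Prop :=
  continuous f /\
  match k with
  | 0 => True
  | k'.+1 => forall i : 'I_n, (forall x, derivable f x (basis_rV i)) /\
               Ck k' ('D_(basis_rV i) f)
  end.

Definition tsupport f : set 'rV[R]_n := closure [set x | f x != 0].

Definition test_function Omega f : Prop :=
  [/\ forall k, Ck k f, compact (tsupport f) & tsupport f `<=` Omega].

Definition Lp_loc Omega (p : R) f : Prop :=
  forall K, compact K -> K `<=` Omega -> f \_ K \in Lfun (lebesgue_rV n) p%:E.

Definition weak_partial Omega (i : 'I_n) f g : Prop :=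
  forall eta, test_function Omega eta ->
    (\int[lebesgue_rV n]_(x in Omega) (f x * 'D_(basis_rV i) eta x)%:E =
     - \int[lebesgue_rV n]_(x in Omega) (g x * eta x)%:E)%E.

(* Membership in W^{1,p}_loc only depends on the class of [phi] modulo null
   sets, hence the Borel representative [f]. *)
Definition W1p_loc Omega (p : R) (phi : 'rV[R]_n -> R) : Prop :=
  exists f, [/\ phi = f %[ae (lebesgue_rV n) in Omega],
    Lp_loc Omega p f &
    forall i : 'I_n, exists g, Lp_loc Omega p g /\ weak_partial Omega i f g].

End sobolev.

(* Main.v *)
(** Suppose [u c = 0].  Then [phi <= ln (B / s)] on the cube [Q_s] of side
    [1 / s] with lower corner [c], so the averages of [phi] against bumps
    [eta s] of mass bounded below and supported in [Q_s] tend to [-oo] at least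
    like a multiple of [- ln s]: doubling [s] must decrease them by a fixed
    amount on average.  On the other hand [eta (2 * s) - eta s] is the divergence
    of a field [psi s] supported in [Q_s] and of size [O(s ^ (n - 1))], so the
    change is at most [O(s ^ (n - 1))] times the integral over [Q_s] of the weak
    gradient, which tends to 0 because the gradient is locally in [L^n]. *)

Require Import Defs.
From mathcomp Require Import all_boot all_order all_algebra.
From mathcomp Require Import all_classical all_reals all_analysis.
From mathcomp Require Import measurable_realfun ring lra.

Set Implicit Arguments.
Unset Strict Implicit.
Unset Printing Implicit Defensive.

Import Order.TTheory GRing.Theory Num.Theory.
Import numFieldNormedType.Exports.
Local Open Scope classical_set_scope.
Local Open Scope ring_scope.

(** * Smooth functions of one variable *)

Section smooth.
Context {R : realType}.
Implicit Types f g : R -> R.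

(** The derivative is an existential witness rather than ['D_1 f], so that explicit formulas can be
    supplied order by order. *)
Fixpoint Cn (k : nat) f : Prop :=
  continuous f /\
  if k is k'.+1 then 
    exists f' : R -> R, (forall t : R, is_derive t (1 : R) f (f' t)) /\ Cn k' f'
 
  else True.

Lemma Cn_continuous {k f} : Cn k f -> continuous f.
Proof. by case: k => [|k] []. Qed.

Lemma Cn_derive k f f' :
  (forall t : R, is_derive t (1 : R) f (f' t)) -> Cn k f' -> Cn k.+1 f.
Proof.
move=> df kf'; split; last by exists f'.
move=> t; apply/differentiable_continuous/derivable1_diffP.
by have [] := df t.
Qed.

Lemma CnW k f : Cn k.+1 f -> Cn k f.
Proof.
elim: k f => [f [] //|k IH f [cf [f' [df kf']]]].
by split=> //; exists f'; split=> //; exact: IH.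
Qed.

Lemma Cn_cst k (a : R) : Cn k (cst a).
Proof.
elim: k a => [|k IH] a; first by split=> // x; exact: cvg_cst.
exact: (@Cn_derive _ _ (cst 0)).
Qed.

Lemma CnD k f g : Cn k f -> Cn k g -> Cn k (f + g).
Proof.
elim: k f g => [|k IH] f g.
  by move=> [cf _] [cg _]; split=> // x; apply: cvgD; [exact: cf|exact: cg].
move=> [_ [f' [df kf']]] [_ [g' [dg kg']]].
by apply: (@Cn_derive _ _ (f' + g')); exact: IH.
Qed.

Lemma CnM k f g : Cn k f -> Cn k g -> Cn k (f * g).
Proof.
elim: k f g => [|k IH] f g.
  by move=> [cf _] [cg _]; split=> // x; apply: cvgM; [exact: cf|exact: cg].
move=> kf kg; have [_ [f' [df kf']]] := kf; have [_ [g' [dg kg']]] := kg.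
apply: (@Cn_derive _ _ (f * g' + g * f')).
by apply: CnD; apply: IH => //; exact: CnW.
Qed.

Lemma Cn_id k : Cn k (@id R).
Proof.
case: k => [|k]; first by split=> // x; exact: cvg_id.
by apply: (@Cn_derive _ _ (cst 1)); exact: Cn_cst.
Qed.

Lemma Cn_comp k f g : Cn k f -> Cn k g -> Cn k (f \o g).
Proof.
elim: k f g => [|k IH] f g.
  by move=> [cf _] [cg _]; split=> // x; apply: continuous_comp;
    [exact: cg|exact: cf].
move=> kf kg; have [_ [f' [df kf']]] := kf; have [_ [g' [dg kg']]] := kg.
apply: (@Cn_derive _ _ ((f' \o g) * g')).
by apply: CnM => //; apply: IH => //; exact: CnW.
Qed.

Lemma CnN k f : Cn k f -> Cn k (- f).
Proof.
move=> kf; rewrite (_ : - f = cst (-1) * f).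
  by apply: CnM => //; exact: Cn_cst.
by apply/funext => x; rewrite /= !fctE mulN1r.
Qed.

Lemma Cn_affine k (a b : R) : Cn k (fun t => a * t + b).
Proof.
apply: (@CnD _ (cst a * id) (cst b)); last exact: Cn_cst.
by apply: CnM; [exact: Cn_cst|exact: Cn_id].
Qed.

(** Each Horner step brings one more factor [s], absorbed by half of the exponential rate; hence the
    induction quantifies over [a]. *)
Lemma horner_le_expR (p : {poly R}) (a : R) : 0 < a ->
  exists2 C, 0 <= C & forall s, 0 <= s -> `|p.[s]| <= C * expR (a * s).
Proof.
elim/poly_ind: p a => [|p c IH] a a0.
  by exists 0 => // s _; rewrite horner0 normr0 mul0r.
have a20 : 0 < a / 2 by rewrite divr_gt0.
have [C C0 CE] := IH _ a20.
exists (C * (a / 2)^-1 + `|c|).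
  by rewrite addr_ge0 // mulr_ge0 // invr_ge0 ltW.
move=> s s0; rewrite hornerD hornerM hornerX hornerC.
rewrite (le_trans (ler_normD _ _)) // mulrDl lerD //; last first.
  rewrite ler_peMr // (le_trans _ (expR_ge1Dx _)) // lerDl.
  by rewrite mulr_ge0 // ltW.
rewrite normrM (ger0_norm s0).
have sE : s <= (a / 2)^-1 * expR (a / 2 * s).
  rewrite mulrC ler_pdivlMr // mulrC (le_trans _ (expR_ge1Dx _)) //.
  by rewrite lerDr.
rewrite (_ : a * s = a / 2 * s + a / 2 * s); last by field.
rewrite expRD mulrACA ler_pM // CE //.
Qed.

(** The polynomial parameter makes the family closed under differentiation, so that smoothness
    becomes a plain induction. *)
Definition flat (p : {poly R}) (t : R) :=
  if 0 < t then p.[t^-1] * expR (- t^-1) else 0.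

(** The growth bound is applied to ['X * p] at [t^-1]: the extra factor [t^-1] moves to the
    right-hand side as [t]. *)
Lemma flat_le_norm p : exists2 C, 0 <= C & forall t : R, `|flat p t| <= C * `|t|.
Proof.
have [C C0 CE] := horner_le_expR ('X * p) (@ltr01 R).
exists C => // t; rewrite /flat; case: ifPn => t0; last first.
  by rewrite normr0 mulr_ge0.
have := CE t^-1; rewrite invr_ge0 ltW // => /(_ isT).
rewrite hornerM hornerX mul1r normrM normfV (gtr0_norm t0) => H.
rewrite normrM (gtr0_norm (expR_gt0 _)) expRN ler_pdivrMr ?expR_gt0 //.
by rewrite (mulrC C) -mulrA -ler_pdivrMl.
Qed.

Lemma flat_derive (p : {poly R}) (t : R) :
  is_derive t (1 : R) (flat p) (flat ('X^2 * (p - p^`())) t).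
Proof.
have [t0|t0|->] := ltgtP t 0.
- have -> : flat ('X^2 * (p - p^`())) t = 0 by rewrite /flat ltNge ltW.
  apply: (@near_eq_is_derive R R R (cst 0)).
  near=> x; rewrite /flat ltNge ltW //=.
  by near: x; exact: lt_nbhsl.
- apply: (@near_eq_is_derive R R R
    (fun x : R => p.[x^-1] * expR (- x^-1))).
    by near=> x; rewrite /flat ifT //; near: x; exact: lt_nbhsr.
  have dV : is_derive t (1 : R) (fun x : R => x^-1) (- t ^- 2 *: 1).
    by apply: is_deriveV; rewrite gt_eqF.
  have -> : flat ('X^2 * (p - p^`())) t =
      p.[t^-1] *: (expR (- t^-1) * (t ^- 2)) +
      expR (- t^-1) *: (p^`().[t^-1] * (- t ^- 2 *: 1)).
    rewrite /flat t0 hornerM hornerXn hornerD hornerN /GRing.scale /= exprVn.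
    by ring.
  have d1 : is_derive t (1 : R) (fun x : R => p.[x^-1])
      (p^`().[t^-1] * (- t ^- 2 *: 1)).
    exact: (@is_derive1_comp R (horner p) (fun x => x^-1)).
  have d2 : is_derive t (1 : R) (fun x : R => expR (- x^-1))
      (expR (- t^-1) * - (- t ^- 2 *: 1)).
    exact: (@is_derive1_comp R expR (fun x => - x^-1)).
  have := is_deriveM d1 d2; rewrite /GRing.scale /= mulr1 opprK; exact.
(* At 0 the difference quotient of [flat p] is [flat ('X * p)], again a member of the family, and
   [flat_le_norm] makes it continuous there. *)
- apply/is_derive1_caratheodory; exists (flat ('X * p)); split.
  + move=> z; rewrite /flat ltxx !subr0.
    case: ifPn => z0; last by rewrite mul0r.
    by rewrite hornerM hornerX; field; rewrite gt_eqF.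
  + have [C C0 CE] := flat_le_norm ('X * p).
    have f0 : flat ('X * p) 0 = 0 by rewrite /flat ltxx.
    rewrite /prop_for /continuous_at f0; apply/cvgr0Pnorm_lt => e e0.
    near=> x; rewrite (le_lt_trans (CE x)) //.
    (* [C] may be 0; [C + 1] can be divided by. *)
    rewrite (@le_lt_trans _ _ ((C + 1) * `|x|)) // ?ler_wpM2r ?lerDl //.
    rewrite -ltr_pdivlMl ?ltr_wpDl //; near: x.
    have h0 : 0 < (C + 1)^-1 * e by rewrite mulr_gt0 // invr_gt0 ltr_wpDl.
    exists ((C + 1)^-1 * e) => //= y; rewrite /ball_ /= sub0r normrN; exact.
  + by rewrite /flat ltxx.
Unshelve. all: by end_near. Qed.

Lemma Cn_flat k p : Cn k (flat p).
Proof.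
elim: k p => [|k IH] p; last exact: (@Cn_derive _ _ _ (flat_derive p)).
split=> // t; apply/differentiable_continuous/derivable1_diffP.
by have [] := flat_derive p t.
Qed.

End smooth.

(** * A smooth step and its derivative, a bump supported in [0, 1] *)

Section step.
Context {R : realType}.

(** This is the value of [flat 1] at 1, so that [e1 - flat 1 (1 - t)] is positive exactly when
    [t > 0]. *)
Let e1 : R := expR (- 1).

(* [flat 1] is the function [exp (- 1 / t)] of [t > 0], and [step] is constant
   outside [0, 1]. *)
Definition step (t : R) : R := flat 1 (e1 - flat 1 (1 - t)).

(** The derivative of [step] by the chain rule: [flat 'X^2] is the derivative of [flat 1], and the
    two minus signs cancel. *)
Definition bump (t : R) : R :=
  flat 'X^2 (e1 - flat 1 (1 - t)) * flat 'X^2 (1 - t).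

Lemma flat1E (t : R) : 0 < t -> flat 1 t = expR (- t^-1).
Proof. by move=> t0; rewrite /flat t0 hornerC mul1r. Qed.

Lemma flat_le0 (p : {poly R}) (t : R) : t <= 0 -> flat p t = 0.
Proof. by move=> t0; rewrite /flat ltNge t0. Qed.

Lemma flatX2_gt0 (t : R) : 0 < t -> 0 < flat 'X^2 t.
Proof.
move=> t0; rewrite /flat t0 hornerXn mulr_gt0 ?expR_gt0 //.
by rewrite exprn_gt0 // invr_gt0.
Qed.

Lemma flatX2_ge0 (t : R) : 0 <= flat 'X^2 t.
Proof.
by have [/flat_le0 ->|/flatX2_gt0/ltW] := leP t 0.
Qed.

Lemma flat1_derive (t : R) : is_derive t (1 : R) (flat 1) (flat 'X^2 t).
Proof.
by have := flat_derive 1 t; rewrite -(polyC1 R) derivC subr0 polyC1 mulr1.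
Qed.

Let flat1_ge (t : R) : t <= 0 -> e1 <= flat 1 (1 - t).
Proof.
move=> t0; have h : 1 <= 1 - t by rewrite lerDl oppr_ge0.
rewrite flat1E ?(lt_le_trans _ h) // ler_expR lerN2 invf_le1 //.
exact: lt_le_trans h.
Qed.

Lemma step_derive (t : R) : is_derive t (1 : R) step (bump t).
Proof.
have dS : is_derive t (1 : R) (fun t : R => 1 - t) (- 1).
  have := is_deriveB (is_derive_cst (1 : R) t (1 : R)) (is_derive_id t (1 : R)).
  by rewrite sub0r.
have d1 : is_derive t (1 : R) (fun t : R => flat 1 (1 - t))
    (flat 'X^2 (1 - t) * - 1).
  apply: (@is_derive1_comp R (flat 1) (fun t => 1 - t)).
  exact: flat1_derive.
have d2 : is_derive t (1 : R) (fun t : R => e1 - flat 1 (1 - t))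
    (flat 'X^2 (1 - t)).
  have := is_deriveB (is_derive_cst e1 t (1 : R)) d1.
  by rewrite mulrN1 opprK add0r.
apply: (@is_derive1_comp R (flat 1) (fun t => e1 - flat 1 (1 - t))).
exact: flat1_derive.
Qed.

Let Cn_inner k p : Cn k (fun t : R => flat p (1 - t)).
Proof.
rewrite (_ : (fun _ => _) = flat p \o (fun t => -1 * t + 1)).
  by apply: Cn_comp; [exact: Cn_flat|exact: Cn_affine].
by apply/funext => t /=; rewrite mulN1r addrC.
Qed.

Let Cn_outer k p : Cn k (fun t : R => flat p (e1 - flat 1 (1 - t))).
Proof.
apply: (@Cn_comp _ _ (flat p) (cst e1 + - (fun t => flat 1 (1 - t)))).
  exact: Cn_flat.
by apply: CnD; [exact: Cn_cst|exact/CnN/Cn_inner].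
Qed.

Lemma Cn_step k : Cn k step. Proof. exact: Cn_outer. Qed.

Lemma Cn_bump k : Cn k bump.
Proof. by apply: CnM; [exact: Cn_outer|exact: Cn_inner]. Qed.

Lemma bump_ge0 (t : R) : 0 <= bump t.
Proof. by rewrite mulr_ge0 // flatX2_ge0. Qed.

Lemma bump_le0 (t : R) : t <= 0 -> bump t = 0.
Proof.
by move=> t0; rewrite /bump flat_le0 ?mul0r // subr_le0 flat1_ge.
Qed.

Lemma bump_ge1 (t : R) : 1 <= t -> bump t = 0.
Proof.
by move=> t1; rewrite /bump (@flat_le0 'X^2 (1 - t)) ?mulr0 // subr_le0.
Qed.

Lemma step_le0 (t : R) : t <= 0 -> step t = 0.
Proof. by move=> t0; rewrite /step flat_le0 // subr_le0 flat1_ge. Qed.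

(** The plateau is not normalised to 1; what matters is that it is the same at all scales, so that
    it cancels in [jump]. *)
Lemma step_ge1 (t : R) : 1 <= t -> step t = flat 1 e1.
Proof.
by move=> t1; rewrite /step (@flat_le0 _ (1 - t)) ?subr0 // subr_le0.
Qed.

Lemma bump_gt0 (t : R) : 0 < t -> t < 1 -> 0 < bump t.
Proof.
move=> t0 t1; rewrite /bump mulr_gt0 ?flatX2_gt0 ?subr_gt0 //.
rewrite flat1E ?subr_gt0 // ltr_expR ltrN2 invf_gt1 ?subr_gt0 //.
by rewrite ltrBlDr ltrDl.
Qed.

Lemma step_bounds (t : R) : 0 <= step t <= 1.
Proof.
rewrite /step; set s := e1 - _; have [s0|s0] := leP s 0.
  by rewrite flat_le0 // lexx ler01.
by rewrite flat1E // expR_ge0 -[leRHS]expR0 ler_expR oppr_le0 invr_ge0 ltW.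
Qed.

Lemma bump_bounded : exists2 M : R, 1 <= M & forall t, bump t <= M.
Proof.
have [|c _ cM] := @EVT_max R bump 0 1 ler01.
  by apply: continuous_subspaceT; exact: (Cn_continuous (Cn_bump 0)).
exists (1 + bump c); first by rewrite lerDl bump_ge0.
move=> t; have [t0|t0] := leP t 0.
  by rewrite bump_le0 // addr_ge0 // bump_ge0.
have [t1|t1] := leP 1 t; first by rewrite bump_ge1 // addr_ge0 // bump_ge0.
by rewrite (le_trans (cM t _)) ?lerDr // in_itv /= (ltW t0) (ltW t1).
Qed.

(** Compactness makes positivity uniform on a window inside the support; after scaling, this window
    becomes the subcube of [eta_ge]. *)
Lemma bump_minorant : exists2 m : R, 0 < m &
  forall t, 1/4 <= t <= 1/2 -> m <= bump t.
Proof.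
have h : (1/4 : R) <= 1/2 by lra.
have [|c] := @EVT_min R bump _ _ h.
  by apply: continuous_subspaceT; exact: (Cn_continuous (Cn_bump 0)).
rewrite in_itv /= => /andP[c1 c2] cM.
exists (bump c) => [|t tE]; first by apply: bump_gt0; lra.
by apply: cM; rewrite in_itv.
Qed.

End step.

(** * Tensor products as test functions *)

Section tensor.
Context {R : realType} (n : nat).
Implicit Types (h : 'I_n -> R -> R) (x c : 'rV[R]_n).

Definition tensor h x : R := \prod_i h i (x 0 i).

Definition cube c (r : R) : set 'rV[R]_n :=
  [set x | forall i, x 0 i \in `[c 0 i, c 0 i + r]].

Lemma continuous_tensor h : (forall i, continuous (h i)) -> continuous (tensor h).
Proof.
move=> ch; apply: continuous_big => [|i _ x]; first exact: mul_continuous.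
exact: (continuous_comp (@coord_continuous R 1 n 0 i x) (ch i (x 0 i))).
Qed.

Definition subst h (j : 'I_n) (f : R -> R) i := if i == j then f else h i.

Lemma tensor_substE h j f x :
  tensor (subst h j f) x = f (x 0 j) * \prod_(i | i != j) h i (x 0 i).
Proof.
rewrite /tensor (bigD1 j) //= /subst eqxx; congr (_ * _).
by apply: eq_bigr => i /negbTE ->.
Qed.

(** Along [basis_rV j] only the [j]-th factor varies, so the difference quotient is that of [h j]
    times the constant [P]. *)
Lemma tensor_derive h j f x :
  is_derive (x 0 j) (1 : R) (h j) (f (x 0 j)) ->
  is_derive x (basis_rV j) (tensor h) (tensor (subst h j f) x).
Proof.
move=> [dh hE]; rewrite tensor_substE.
set P := \prod_(i | _) _.
have E : (fun t : R => t^-1 *: (tensor h (t *: basis_rV j + x) - tensor h x)) =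
    (fun t : R => (t^-1 *: (h j (t *: 1 + x 0 j) - h j (x 0 j))) * P).
  apply/funext => t; rewrite /tensor !(bigD1 j (P := xpredT)) //=.
  rewrite (_ : \prod_(i | i != j) _ = P); last first.
    by apply: eq_bigr => i /negbTE ij; rewrite !mxE ij andbF mulr0 add0r.
  by rewrite !mxE !eqxx -mulrBl scalerAl.
have cP : (fun t : R => (t^-1 *: (h j (t *: 1 + x 0 j) - h j (x 0 j))) * P) @ 0^'
    --> f (x 0 j) * P.
  by apply: cvgMl; rewrite -hE; exact: dh.
apply: DeriveDef; first by rewrite /derivable E; apply/cvg_ex; exists (f (x 0 j) * P).
by rewrite /derive E; exact: cvg_lim.
Qed.

(** A partial derivative is again a tensor, with one factor replaced; hence the induction runs over
    all families [h]. *)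
Lemma Ck_tensor k h : (forall i, Cn k (h i)) -> Ck k (tensor h).
Proof.
elim: k h => [|k IH] h hk.
  by split=> //; apply: continuous_tensor => i; exact: Cn_continuous (hk i).
split; first by apply: continuous_tensor => i; exact: Cn_continuous (hk i).
move=> j; have [_ [f [df kf]]] := hk j.
have D x := @tensor_derive h j f x (df (x 0 j)).
split=> [x|]; first by have [] := D x.
rewrite (_ : 'D_ _ _ = tensor (subst h j f)); last first.
  by apply/funext => x; have [] := D x.
apply: IH => i; rewrite /subst; case: ifP => // _; exact/CnW.
Qed.

Lemma compact_cube c r : compact (cube c r).
Proof.
apply: (@rV_compact R n (fun i => `[c 0 i, c 0 i + r]%classic)) => i.
exact: segment_compact.
Qed.

Lemma closed_cube c r : closed (cube c r).
Proof.
apply: compact_closed; [exact: norm_hausdorff|exact: compact_cube].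
Qed.

Lemma tensor_neq0_cube h c r x :
  (forall i t, h i t != 0 -> t \in `[c 0 i, c 0 i + r]) ->
  tensor h x != 0 -> cube c r x.
Proof. by move=> H /prodf_neq0 hx i; exact/H/hx. Qed.

Lemma test_function_tensor Omega h c r : (forall k i, Cn k (h i)) ->
  (forall i t, h i t != 0 -> t \in `[c 0 i, c 0 i + r]) ->
  cube c r `<=` Omega -> test_function Omega (tensor h).
Proof.
move=> hk hc cO.
have sc : tsupport (tensor h) `<=` cube c r.
  rewrite /tsupport closureE; apply: smallest_sub; first exact: closed_cube.
  by move=> x /=; exact: tensor_neq0_cube.
split=> [k||]; first exact/Ck_tensor.
- by apply: subclosed_compact sc; [exact: closed_closure|exact: compact_cube].
- exact: subset_trans cO.
Qed.

End tensor.

(** The [j]-th summand is the difference of two consecutive hybrid products [T j - T j.+1], where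
    [T m] takes its first [m] factors from [a] and the others from [b]. *)
Lemma telescope_prod (R : comPzRingType) n (a b : 'I_n -> R) :
  \sum_(j < n) \prod_(i < n)
    (if (i < j)%N then a i else if i == j then b i - a i else b i) =
  \prod_(i < n) b i - \prod_(i < n) a i.
Proof.
pose T m := \prod_(i < n) (if (i < m)%N then a i else b i).
have -> : \prod_(i < n) b i = T 0%N by [].
have -> : \prod_(i < n) a i = T n.
  by apply: eq_bigr => i _; rewrite ltn_ord.
have := telescope_sumr T (leq0n n); rewrite big_mkord => H.
rewrite -[LHS]opprK -sumrN -opprB -H; congr (- _).
apply: eq_bigr => j _; rewrite /T !(bigD1 j (P := xpredT)) //= ltnn ltnSn eqxx.
rewrite -mulNr opprB mulrBl; congr (_ * _ - _ * _); apply: eq_bigr => i ij.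
- by rewrite ltnS [(i <= j)%N]leq_eqVlt (negbTE (ij : i != j :> nat)) (negbTE ij).
- by rewrite (negbTE ij).
Qed.

(** * Dilated bumps and primitives of their differences *)

Section dilation.
Context {R : realType}.

(** The factor [s] makes the integral independent of the scale. *)
Definition dil (s a t : R) : R := s * bump (s * (t - a)).

(** A primitive of [dil (2 * s) a - dil s a]; it has compact support because the two dilations have
    equal mass. *)
Definition jump (s a t : R) : R := step (2 * s * (t - a)) - step (s * (t - a)).

Let affineE (s a : R) : (fun t => s * (t - a)) = (fun t => s * t + (- (s * a))).
Proof. by apply/funext => t; rewrite mulrBr. Qed.

Let affine_derive (s a t : R) : is_derive t (1 : R) (fun t => s * (t - a)) s.
Proof.
rewrite affineE.
have := is_deriveD (is_deriveZ s (is_derive_id t (1 : R)))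
  (is_derive_cst (- (s * a)) t (1 : R)).
by rewrite addr0 /GRing.scale /= mulr1.
Qed.

Lemma Cn_dil k s a : Cn k (dil s a).
Proof.
apply: (@CnM _ _ (cst s) (bump \o (fun t => s * (t - a)))); first exact: Cn_cst.
by apply: Cn_comp; [exact: Cn_bump|rewrite affineE; exact: Cn_affine].
Qed.

Lemma Cn_jump k s a : Cn k (jump s a).
Proof.
have H r : Cn k (step \o (fun t => r * (t - a))).
  by apply: Cn_comp; [exact: Cn_step|rewrite affineE; exact: Cn_affine].
by apply: (@CnD _ _ _ (- (step \o (fun t => s * (t - a))))); [exact: H|exact/CnN/H].
Qed.

Lemma jump_derive s a (t : R) :
  is_derive t (1 : R) (jump s a) (dil (2 * s) a t - dil s a t).
Proof.
have H r : is_derive t (1 : R) (fun t => step (r * (t - a))) (dil r a t).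
  rewrite /dil mulrC; apply: (@is_derive1_comp R step (fun t => r * (t - a))).
    exact: step_derive.
  exact: affine_derive.
exact: is_deriveB (H (2 * s)) (H s).
Qed.

Lemma dil_supp (s a t : R) : 0 < s -> dil s a t != 0 -> t \in `[a, a + s^-1].
Proof.
move=> s0; apply: contraNT; rewrite in_itv /= negb_and -!ltNge => /orP[ta|ta].
  by rewrite /dil bump_le0 ?mulr0 // pmulr_rle0 // subr_le0 ltW.
rewrite /dil bump_ge1 ?mulr0 // mulrC -ler_pdivrMr // div1r.
by rewrite lerBrDl ltW.
Qed.

(** The support is in fact half as long; the larger interval lets both scales share one cube. *)
Lemma dil2_supp (s a t : R) :
  0 < s -> dil (2 * s) a t != 0 -> t \in `[a, a + s^-1].
Proof.
move=> s0 /(dil_supp (mulr_gt0 (ltr0Sn R 1) s0)).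
rewrite !in_itv /= => /andP[-> h] /=; apply: le_trans h _; rewrite lerD2l.
by rewrite lef_pV2 ?posrE ?mulr_gt0 //; lra.
Qed.

Lemma jump_supp (s a t : R) : 0 < s -> jump s a t != 0 -> t \in `[a, a + s^-1].
Proof.
move=> s0; apply: contraNT; rewrite in_itv /= negb_and -!ltNge => /orP[ta|ta].
  by rewrite /jump !step_le0 ?subrr // pmulr_rle0 ?mulr_gt0 // subr_le0 ltW.
have h : 1 <= s * (t - a).
  by rewrite mulrC -ler_pdivrMr // div1r lerBrDl ltW.
by rewrite /jump !step_ge1 ?subrr // -mulrA; lra.
Qed.

(** No power of [s] appears here, whereas [dil s a] has size [s]: this is why [psi s] has size
    [s ^+ n.-1] only. *)
Lemma jump_le1 s a t : `|jump s a t| <= 1.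
Proof.
rewrite /jump; set x := step _; set y := step _.
have /andP[x0 x1] : 0 <= x <= 1 by exact: step_bounds.
have /andP[y0 y1] : 0 <= y <= 1 by exact: step_bounds.
by rewrite ler_norml; apply/andP; split; lra.
Qed.

Lemma dil_ge0 (s a t : R) : 0 <= s -> 0 <= dil s a t.
Proof. by move=> s0; rewrite mulr_ge0 // bump_ge0. Qed.

End dilation.

(** * The averaging functions [eta] and the fields [psi] joining consecutive scales *)

Section test_family.
Context {R : realType} (n : nat) (c : 'rV[R]_n).
Implicit Types (s : R) (x : 'rV[R]_n).

Definition eta s := tensor (fun i => dil s (c 0 i)).

(* Passing from [eta s] to [eta (2 * s)] one coordinate at a time turns the
   difference into the divergence of the field [psi s]. *)
Definition psi s (j : 'I_n) := tensor (fun i =>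
  if (i < j)%N then dil s (c 0 i)
  else if i == j then jump s (c 0 i) else dil (2 * s) (c 0 i)).

Lemma test_psi Omega s j : 0 < s -> cube c s^-1 `<=` Omega ->
  test_function Omega (psi s j).
Proof.
move=> s0; apply: test_function_tensor => [k i|i t].
  by case: ifP => _; [|case: ifP => _]; (exact: Cn_dil || exact: Cn_jump).
case: ifP => _; [exact: dil_supp|case: ifP => _; [exact: jump_supp|]].
exact: dil2_supp.
Qed.

(** Differentiating the [jump] factor turns the product into the [j]-th summand of
    [telescope_prod]. *)
Lemma psi_derive s j x : is_derive x (basis_rV j) (psi s j)
  (tensor (fun i => if (i < j)%N then dil s (c 0 i)
    else if i == j then (fun t => dil (2 * s) (c 0 i) t - dil s (c 0 i) t)
    else dil (2 * s) (c 0 i)) x).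
Proof.
have := @tensor_derive R n (fun i =>
  if (i < j)%N then dil s (c 0 i)
  else if i == j then jump s (c 0 i) else dil (2 * s) (c 0 i)) j
  (fun t => dil (2 * s) (c 0 j) t - dil s (c 0 j) t) x.
rewrite ltnn eqxx => /(_ (jump_derive _ _ _)).
congr is_derive; apply: eq_bigr => i _; rewrite /subst.
by have [->|] := eqVneq i j; rewrite ?ltnn.
Qed.

Lemma sum_derive_psi s x :
  \sum_(j < n) 'D_(basis_rV j) (psi s j) x = eta (2 * s) x - eta s x.
Proof.
rewrite -telescope_prod; apply: eq_bigr => j _.
have [_ ->] := psi_derive s j x; apply: eq_bigr => i _.
by case: ifP => // _; case: ifP.
Qed.

Lemma eta_supp s x : 0 < s -> eta s x != 0 -> cube c s^-1 x.
Proof. by move=> s0; apply: tensor_neq0_cube => i t; exact: dil_supp. Qed.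

Lemma eta2_supp s x : 0 < s -> eta (2 * s) x != 0 -> cube c s^-1 x.
Proof. by move=> s0; apply: tensor_neq0_cube => i t; exact: dil2_supp. Qed.

Lemma psi_supp s j x : 0 < s -> psi s j x != 0 -> cube c s^-1 x.
Proof.
move=> s0; apply: tensor_neq0_cube => i t.
case: ifP => _; [exact: dil_supp|case: ifP => _; [exact: jump_supp|]].
exact: dil2_supp.
Qed.

Lemma derive_psi_supp s j x :
  0 < s -> 'D_(basis_rV j) (psi s j) x != 0 -> cube c s^-1 x.
Proof.
move=> s0; have [_ ->] := psi_derive s j x.
apply: tensor_neq0_cube => i t.
case: ifP => _; [exact: dil_supp|case: ifP => _; [|exact: dil2_supp]].
have [h|/dil_supp -> //] := eqVneq (dil s (c 0 i) t) 0.
by rewrite h subr0; exact: dil2_supp.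
Qed.

Lemma eta_ge0 s x : 0 <= s -> 0 <= eta s x.
Proof. by move=> s0; apply: prodr_ge0 => i _; exact: dil_ge0. Qed.

Lemma continuous_eta s : continuous (eta s).
Proof. by apply: continuous_tensor => i; exact: (Cn_continuous (Cn_dil 0 _ _)). Qed.

Lemma continuous_psi s j : continuous (psi s j).
Proof.
apply: continuous_tensor => i; apply: (@Cn_continuous _ 0).
by case: ifP => _; [|case: ifP => _]; (exact: Cn_dil || exact: Cn_jump).
Qed.

Lemma continuous_derive_psi s j : continuous ('D_(basis_rV j) (psi s j)).
Proof.
rewrite (_ : 'D_ _ _ = tensor (fun i => if (i < j)%N then dil s (c 0 i)
    else if i == j then (fun t => dil (2 * s) (c 0 i) t - dil s (c 0 i) t)
    else dil (2 * s) (c 0 i))); last first.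
  by apply/funext => x; have [] := psi_derive s j x.
apply: continuous_tensor => i; apply: (@Cn_continuous _ 0).
case: ifP => _; [exact: Cn_dil|case: ifP => _; [|exact: Cn_dil]].
by apply: (@CnD _ _ _ (- dil s (c 0 i))); [exact: Cn_dil|exact/CnN/Cn_dil].
Qed.

(** The [j]-th factor is at most 1 by [jump_le1], and each of the other [n.-1] factors is at most
    [2 * s * M]. *)
Lemma psi_le (M s : R) j x : 1 <= M -> (forall t, bump t <= M) -> 0 < s ->
  `|psi s j x| <= (2 * s * M) ^+ n.-1.
Proof.
move=> M1 bM s0; have M0 : 0 <= M by exact: le_trans M1.
rewrite /psi /tensor (bigD1 j) //= ltnn eqxx normrM.
rewrite (_ : _ ^+ _ = 1 * \prod_(i < n | i != j) (2 * s * M)); last first.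
  by rewrite mul1r prodr_const cardC1 card_ord.
rewrite ler_pM // ?jump_le1 // normr_prod; apply: ler_prod => i ij.
rewrite normr_ge0 (negbTE ij) /=.
have s20 : 0 <= 2 * s by rewrite mulr_ge0 // ltW.
case: ifP => _; rewrite ger0_norm ?dil_ge0 ?(ltW s0) // /dil.
  apply: ler_pM; rewrite ?bump_ge0 ?(ltW s0) //.
  lra.
by rewrite ler_wpM2l.
Qed.

(** On this subcube each rescaled coordinate [s * (x 0 i - c 0 i)] lies in [1/4, 1/2], where [bump]
    is at least [m]. *)
Lemma eta_ge (m s : R) x : 0 < m -> (forall t, 1/4 <= t <= 1/2 -> m <= bump t) ->
  0 < s -> cube (c + const_mx (4 * s)^-1) (4 * s)^-1 x ->
  (s * m) ^+ n <= eta s x.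
Proof.
move=> m0 bm s0 cx; rewrite (_ : _ ^+ _ = \prod_(i < n) (s * m)); last first.
  by rewrite prodr_const card_ord.
apply: ler_prod => i _; rewrite mulr_ge0 ?(ltW s0) ?(ltW m0) //=.
rewrite /dil ler_wpM2l ?(ltW s0) //; apply: bm.
have := cx i; rewrite in_itv /= !mxE invfM => /andP[h1 h2].
have -> : 1/4 = s * (4^-1 * s^-1) by field; rewrite gt_eqF.
have -> : 1/2 = s * (4^-1 * s^-1 + 4^-1 * s^-1) by field; rewrite gt_eqF.
by rewrite !ler_pM2l // lerBrDl h1 lerBlDl addrA.
Qed.

End test_family.

(** * Integration over cubes *)

Section integration.
Context {R : realType} (n : nat).
Notation mu := (@lebesgue_rV R n).
Implicit Types (c x : 'rV[R]_n) (F G b : 'rV[R]_n -> R).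

Lemma continuous_measurable_rV b : continuous b -> measurable_fun setT b.
Proof.
move=> /continuousP cb.
apply: (measurability _ (RGenOpens.measurableE R)).
move=> _ [_ [x [y ->] <-]]; rewrite setTI; apply: open_measurable_rV.
exact/cb/interval_open.
Qed.

Lemma measurable_cube c r : measurable (cube c r).
Proof.
rewrite -[cube c r]setCK; apply: measurableC; apply: open_measurable_rV.
exact/closed_openC/closed_cube.
Qed.

Lemma lebesgue_cube c (r : R) : 0 <= r -> mu (cube c r) = (r ^+ n)%:E.
Proof.
move=> r0; have E i : (c + const_mx r) 0 i = c 0 i + r by rewrite !mxE.
have -> : cube c r =
    [set x | forall i, x 0 i \in `[c 0 i, (c + const_mx r) 0 i]].
  by apply/seteqP; split=> x /= h i; move: (h i); rewrite E.
rewrite lebesgue_rV_box => [|i]; last by rewrite E lerDl.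
congr EFin; transitivity (\prod_(i < n) r); last by rewrite prodr_const card_ord.
by apply: eq_bigr => i _; rewrite E addrC addKr.
Qed.

Lemma integrable_mul_bounded F b : mu.-integrable setT (EFin \o F) ->
  continuous b -> (exists M, forall x, `|b x| <= M) ->
  mu.-integrable setT (EFin \o (F \* b)).
Proof.
move=> iF cb [M bM]; have := @integrableMl _ _ _ mu _ measurableT _ _ iF
  (continuous_measurable_rV cb).
apply; exists M; split; first exact: num_real.
by move=> y My x _ /=; rewrite (le_trans (bM x)) // ltW.
Qed.

Lemma continuous_bounded_cube c r b : 0 <= r -> continuous b ->
  (forall x, b x != 0 -> cube c r x) -> exists M, forall x, `|b x| <= M.
Proof.
move=> r0 cb bs.
have [|||y _ yM] := @EVT_max_rV R n (fun x => `|b x|) (cube c r).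
- by exists c => i; rewrite in_itv /= lexx lerDl.
- exact: compact_cube.
- apply: continuous_subspaceT => x.
  by apply: continuous_comp; [exact: cb|exact: norm_continuous].
exists `|b y| => x; have [->|/bs cx] := eqVneq (b x) 0; first by rewrite normr0.
exact/yM/mem_set.
Qed.

Lemma integrable_cube c r (a : R) : 0 <= r ->
  mu.-integrable setT (EFin \o (cst a \_ (cube c r))).
Proof.
move=> r0; rewrite -restrict_EFin; apply/integrable_restrict => //.
  exact: measurable_cube.
rewrite setTI; apply: measurable_bounded_integrable.
- exact: measurable_cube.
- by rewrite [X in (X < _)%E]lebesgue_cube // ltry.
- exact: measurable_cst.
- exists `|a|; split; first exact: num_real.
  by move=> y ay x _ /=; exact: ltW.
Qed.

Lemma Rintegral_cube c r (a : R) : 0 <= r ->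
  \int[mu]_x (cst a \_ (cube c r)) x = a * r ^+ n.
Proof.
move=> r0; rewrite -Rintegral_mkcond Rintegral_cst; last exact: measurable_cube.
by rewrite [X in fine X]lebesgue_cube.
Qed.

(** Both conclusions are proved together, since additivity at each step needs the integrability of
    the remaining sum. *)
Lemma Rintegral_sumr (I : Type) (r : seq I) (h : I -> 'rV[R]_n -> R) :
  (forall i, mu.-integrable setT (EFin \o h i)) ->
  mu.-integrable setT (EFin \o (fun x => \sum_(i <- r) h i x)) /\
  \int[mu]_x (\sum_(i <- r) h i x) = \sum_(i <- r) \int[mu]_x (h i x).
Proof.
move=> ih; elim: r => [|i r [IH1 IH2]].
  split; first by under eq_fun do rewrite big_nil; exact: integrable0.
  by rewrite big_nil; under eq_Rintegral do rewrite big_nil;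
     rewrite Rintegral_cst // mul0r.
have E x : \sum_(j <- i :: r) h j x = h i x + \sum_(j <- r) h j x.
  by rewrite big_cons.
split.
  have := integrableD measurableT (ih i) IH1; apply: eq_integrable => // x _.
  by rewrite /= E EFinD.
by rewrite big_cons -IH2 -RintegralD //; apply: eq_Rintegral => x _.
Qed.

Section local_Lp.
Variables (c : 'rV[R]_n) (r : R) (f : 'rV[R]_n -> R).
Hypotheses (n0 : (0 < n)%N) (r0 : 0 <= r)
  (fL : f \_ (cube c r) \in Lfun mu n%:R%:E).

Lemma Lp_integrable_exprn :
  mu.-integrable setT (EFin \o (fun x => `|(f \_ (cube c r)) x| ^+ n)).
Proof.
have n1 : 1 <= n%:R :> R by rewrite ler1n.
have := Lfun_integrable n1 fL.
by under eq_fun do rewrite powR_mulrn //.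
Qed.

(** The cube has finite measure, and [1 + |t| ^ n] dominates [|t|]. *)
Lemma Lp_integrable : mu.-integrable setT (EFin \o (f \_ (cube c r))).
Proof.
have i1 := integrable_cube c 1 r0.
have iD := integrableD measurableT i1 Lp_integrable_exprn.
apply: (le_integrable measurableT _ _ iD).
  apply/measurable_EFinP; move: fL; rewrite inE => /andP[/=].
  by rewrite inE.
move=> x _; rewrite /= lee_fin [leRHS]ger0_norm; last first.
  by rewrite addr_ge0 ?exprn_ge0 // patchE; case: ifP.
rewrite !patchE; case: ifPn => _; last by rewrite normr0 add0r exprn_ge0.
set t := f x; have [t1|t1] := leP `|t| 1.
  by rewrite (le_trans t1) // lerDl exprn_ge0.
rewrite (@le_trans _ _ (`|t| ^+ n)) ?lerDr // -[leLHS]expr1.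
by rewrite ler_weXn2l // ltW.
Qed.

End local_Lp.

End integration.

(** Either [y <= e * s], and the first term suffices, or [s < y / e], and the second does. In
    [small_pairing] this plays the part of Hölder's inequality. *)
Lemma young_split (R : realFieldType) (m : nat) (e s y : R) :
  0 < e -> 0 < s -> 0 <= y ->
  y * s ^+ m <= e * s ^+ m.+1 + e^-1 ^+ m * y ^+ m.+1.
Proof.
move=> e0 s0 y0; have [ys|ys] := leP y (e * s).
  rewrite -[leLHS]addr0 lerD //.
    by rewrite exprS mulrA ler_wpM2r // exprn_ge0 // ltW.
  by rewrite mulr_ge0 // exprn_ge0 // invr_ge0 ltW.
rewrite -[leLHS]add0r lerD //.
  by rewrite mulr_ge0 ?exprn_ge0 // ltW.
rewrite [y ^+ m.+1]exprS mulrCA -exprMn ler_wpM2l //.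
by rewrite lerXn2r ?nnegrE ?mulr_ge0 ?invr_ge0 ?(ltW e0) ?(ltW s0) // ler_pdivlMl // ltW.
Qed.

(** * Estimates for small cubes *)

Section estimates.
Context {R : realType} (n : nat).
Notation mu := (@lebesgue_rV R n).
Implicit Types (c x : 'rV[R]_n) (F G b : 'rV[R]_n -> R).

(** On the cube [K] of side [s^-1], [young_split] bounds [|G| * s ^+ n.-1] by [e * s ^+ n] plus a
    multiple of [|G| ^+ n]. The first term integrates to [e] because [K] has volume [s ^- n]; the
    second to at most [e] by absolute continuity of the integral of [|G| ^+ n]. *)
Lemma small_pairing c G (C e : R) : (0 < n)%N -> 0 <= C -> 0 < e ->
  mu.-integrable setT (EFin \o G) ->
  mu.-integrable setT (EFin \o (fun x => `|G x| ^+ n)) ->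
  exists2 S : R, 0 < S & forall s b, S <= s -> continuous b ->
    (forall x, `|b x| <= C * s ^+ n.-1) ->
    (forall x, b x != 0 -> cube c s^-1 x) ->
    `|\int[mu]_x (G x * b x)| <= C * (2 * e).
Proof.
move=> n0 C0 e0 iG iGn.
have [d [d0 dP]] := integral_normr_continuous iGn (exprn_gt0 n e0).
(* This forces [s >= 1], so that the volume [s ^- n] is at most [s^-1], and also [s^-1 < d]. *)
exists (1 + d^-1) => [|s b sS cb bC bK].
  by rewrite addr_gt0 // invr_gt0.
have s1 : 1 <= s by apply: le_trans sS; rewrite lerDl invr_ge0 ltW.
have s0 : 0 < s by exact: lt_le_trans s1.
have sV0 : 0 <= s^-1 by rewrite invr_ge0 ltW.
have mK := measurable_cube c s^-1.
pose K := cube c s^-1.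
have muK : (mu K < d%:E)%E.
  rewrite [X in (X < _)%E]lebesgue_cube // lte_fin.
  rewrite (@le_lt_trans _ _ s^-1) //.
    by rewrite -[leRHS]expr1 ler_wiXn2l // invf_le1.
  rewrite -[ltRHS]invrK ltf_pV2 ?posrE ?invr_gt0 //.
  by rewrite (lt_le_trans _ sS) // ltrDr.
have IG : \int[mu]_(x in K) `|G x| ^+ n <= e ^+ n.
  have := dP K mK muK.
  by under eq_Rintegral do rewrite ger0_norm ?exprn_ge0 //; exact: ltW.
have bb : exists M, forall x, `|b x| <= M by exists (C * s ^+ n.-1).
have iGb := integrable_mul_bounded iG cb bb.
apply: le_trans (le_normr_Rintegral measurableT iGb) _.
have i1 := integrable_cube c (C * (e * s ^+ n)) sV0.
have i2 : mu.-integrable setT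
    (EFin \o ((fun x => C * e^-1 ^+ n.-1 * `|G x| ^+ n) \_ K)).
  rewrite -restrict_EFin; apply/integrable_restrict => //.
  rewrite setTI; apply: (integrableS measurableT) => //.
  exact: (integrableZl measurableT _ iGn).
apply: (@le_trans _ _ (\int[mu]_x ((cst (C * (e * s ^+ n)) \_ K) x +
   ((fun x => C * e^-1 ^+ n.-1 * `|G x| ^+ n) \_ K) x))).
  apply: le_Rintegral => //.
  - exact: integrable_norm.
  - exact: (integrableD measurableT i1 i2).
  move=> x _ /=; rewrite !patchE; case: ifPn => xK; last first.
    rewrite addr0; have [->|/bK/mem_set] := eqVneq (b x) 0.
      by rewrite mulr0 normr0.
    by rewrite (negbTE xK).
  rewrite -mulrA -mulrDr normrM.
  rewrite (le_trans (ler_wpM2l (normr_ge0 _) (bC x))) // mulrCA ler_wpM2l //.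
  by have := @young_split _ n.-1 e s `|G x| e0 s0 (normr_ge0 _); rewrite prednK.
rewrite RintegralD // Rintegral_cube // -Rintegral_mkcond.
rewrite RintegralZl //; last exact: (integrableS measurableT).
rewrite mulr2n mulrDl mul1r mulrDr lerD //.
  by rewrite exprVn mulrA mulfK // gt_eqF // exprn_gt0.
rewrite -mulrA ler_wpM2l // exprVn ler_pdivrMl ?exprn_gt0 //.
by rewrite -exprSr prednK.
Qed.

(** The difference [G - F] agrees almost everywhere with its absolute value, whose integral is
    nonnegative. *)
Lemma ae_le_Rintegral F G : mu.-integrable setT (EFin \o F) ->
  mu.-integrable setT (EFin \o G) -> {ae mu, forall x, F x <= G x} ->
  \int[mu]_x F x <= \int[mu]_x G x.
Proof.
move=> iF iG FG; rewrite -subr_ge0 -RintegralB //.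
have iB : mu.-integrable setT (EFin \o (fun x => G x - F x)).
  exact: (integrableB measurableT iG iF).
rewrite (_ : \int[mu]_x _ = \int[mu]_x `|G x - F x|).
  exact: Rintegral_ge0.
congr fine; apply: ae_eq_integral => //.
- exact: measurable_int iB.
- exact: measurable_int (integrable_norm iB).
- by apply: filterS FG => x FGx _; rewrite ger0_norm // subr_ge0.
Qed.

(** As [v <= 0], the integrand is at most [v * (s * m) ^+ n] on the subcube of [eta_ge] and at most
    0 elsewhere. The subcube has volume [(4 * s) ^- n], so the powers of [s] cancel. *)
Lemma Rintegral_eta_le c F (m v s : R) : 0 < m ->
  (forall t, 1/4 <= t <= 1/2 -> m <= bump t) -> 0 < s -> v <= 0 ->
  mu.-integrable setT (EFin \o F) ->
  {ae mu, forall x, cube c s^-1 x -> F x <= v} ->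
  \int[mu]_x (F x * eta c s x) <= v * (m / 4) ^+ n.
Proof.
move=> m0 bm s0 v0 iF Fv.
have sV0 : 0 <= s^-1 by rewrite invr_ge0 ltW.
have s4V0 : 0 <= (4 * s)^-1 by rewrite invr_ge0 mulr_ge0 // ltW.
have eb : exists M, forall x, `|eta c s x| <= M.
  apply: (@continuous_bounded_cube _ _ c s^-1) => //.
    exact: continuous_eta.
  by move=> x; exact: eta_supp.
have ieb := integrable_mul_bounded iF (@continuous_eta R n c s) eb.
pose Q := cube (c + const_mx (4 * s)^-1) (4 * s)^-1.
pose q := cst (v * (s * m) ^+ n) \_ Q.
have iq : mu.-integrable setT (EFin \o q) by exact: integrable_cube.
have -> : v * (m / 4) ^+ n = \int[mu]_x q x.
  rewrite /q Rintegral_cube // -mulrA -exprMn; congr (_ * _ ^+ _).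
  by field; rewrite gt_eqF.
apply: ae_le_Rintegral => //; apply: filterS Fv => x Fv.
rewrite /q patchE; case: ifPn => [/set_mem xQ|_].
  have ge := eta_ge m0 bm s0 xQ.
  have gt0 : 0 < eta c s x by apply: lt_le_trans ge; rewrite exprn_gt0 // mulr_gt0.
  have {}Fv : F x <= v by apply: Fv; apply: eta_supp => //; rewrite gt_eqF.
  rewrite (@le_trans _ _ (v * eta c s x)) //; first by rewrite ler_pM2r.
  by rewrite ler_wnM2l.
have [->|/(eta_supp s0)/Fv Fxv] := eqVneq (eta c s x) 0; first by rewrite mulr0.
by rewrite mulr_le0_ge0 ?eta_ge0 ?(ltW s0) // (le_trans Fxv).
Qed.

End estimates.

(** * The contradiction *)

(** After [p] steps [A] has lost at most [p * d], but its upper bound has lost [2 * p * d]; a large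
    [p] is absurd. *)
Lemma no_slow_decrease (R : archiRealFieldType) (A : nat -> R) (d b : R) :
  0 < d -> (forall k, A k - d <= A k.+1) ->
  (forall k, A k <= b - k%:R * (2 * d)) -> False.
Proof.
move=> d0 lo up.
have lo' p : A 0%N - p%:R * d <= A p.
  elim: p => [|p IH]; first by rewrite mul0r subr0.
  rewrite (le_trans _ (lo _)) // -natr1 mulrDl mul1r; lra.
pose p := Num.bound `|(b - A 0%N) / d|.
have : `|(b - A 0%N) / d| < p%:R by exact: archi_boundP.
move/(le_lt_trans (ler_norm _)); rewrite ltr_pdivrMr // => h.
have := le_trans (lo' p) (up p); lra.
Qed.

Section blow_up.
Context {R : realType} (n : nat).
Notation mu := (@lebesgue_rV R n).
Implicit Types (c x : 'rV[R]_n) (f g b : 'rV[R]_n -> R).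

(** Since [b] and its derivative vanish off the cube, [f] and [g] may be cut off there and the
    integrals taken over the whole space, where the cut-off functions turn out integrable. *)
Lemma weak_partial_cube Omega c r j f g b : cube c r `<=` Omega ->
  weak_partial Omega j f g -> test_function Omega b ->
  (forall x, b x != 0 -> cube c r x) ->
  (forall x, 'D_(basis_rV j) b x != 0 -> cube c r x) ->
  \int[mu]_x ((f \_ (cube c r)) x * 'D_(basis_rV j) b x) =
  - \int[mu]_x ((g \_ (cube c r)) x * b x).
Proof.
move=> KO fg tb bK DbK.
have E h h' : (forall x, h' x != 0 -> cube c r x) ->
    (\int[mu]_(x in Omega) (h x * h' x)%:E =
     \int[mu]_x ((h \_ (cube c r)) x * h' x)%:E)%E.
  move=> h'K; rewrite integral_mkcond; apply: eq_integral => x _.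
  rewrite !patchE; case: ifPn => [_|xO]; case: ifPn => // xK.
  - have [->|/h'K/mem_set] := eqVneq (h' x) 0; first by rewrite !mulr0.
    by rewrite (negbTE xK).
  - by move/set_mem: xK => /KO/mem_set; rewrite (negbTE xO).
  - by rewrite mul0r.
have := fg b tb; rewrite !E // => H.
by rewrite /Rintegral H fineN.
Qed.

Lemma cubeS c (r r' : R) : r' <= r -> cube c r' `<=` cube c r.
Proof.
move=> rr x cx i; have := cx i; rewrite !in_itv /= => /andP[-> h] /=.
by rewrite (le_trans h) // lerD2l.
Qed.

(** By [sum_derive_psi] the difference of the two test functions is the divergence of [psi c s];
    each component is then integrated by parts. The cube of side [r] stays fixed while [s] grows. *)
Lemma eta_increment Omega c r (s : R) f (g : 'I_n -> 'rV[R]_n -> R) :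
  0 < s -> s^-1 <= r -> cube c r `<=` Omega ->
  (forall j, weak_partial Omega j f (g j)) ->
  mu.-integrable setT (EFin \o (f \_ (cube c r))) ->
  \int[mu]_x ((f \_ (cube c r)) x * eta c (2 * s) x) -
  \int[mu]_x ((f \_ (cube c r)) x * eta c s x) =
  - \sum_(j < n) \int[mu]_x ((g j \_ (cube c r)) x * psi c s j x).
Proof.
move=> s0 sr KO fg iF; set F := f \_ _.
have sV0 : 0 <= s^-1 by rewrite invr_ge0 ltW.
have bnd b : continuous b -> (forall x, b x != 0 -> cube c s^-1 x) ->
    mu.-integrable setT (EFin \o (F \* b)).
  move=> cb bK; apply: integrable_mul_bounded => //.
  exact: continuous_bounded_cube sV0 cb bK.
rewrite -RintegralB //; last 2 first.
- by apply: bnd; [exact: continuous_eta|move=> x; exact: eta2_supp].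
- by apply: bnd; [exact: continuous_eta|move=> x; exact: eta_supp].
have iD j : mu.-integrable setT
    (EFin \o (fun x => F x * 'D_(basis_rV j) (psi c s j) x)).
  apply: bnd; first exact: continuous_derive_psi.
  by move=> x; exact: derive_psi_supp.
rewrite -sumrN; transitivity (\int[mu]_x
    (\sum_(j < n) F x * 'D_(basis_rV j) (psi c s j) x)).
  by apply: eq_Rintegral => x _; rewrite -mulr_sumr sum_derive_psi mulrBr.
rewrite (Rintegral_sumr _ iD).2; apply: eq_bigr => j _.
apply: (@weak_partial_cube Omega) => //.
- by apply: test_psi => //; apply: subset_trans KO; exact: cubeS.
- by move=> x /(psi_supp s0); exact: cubeS.
- by move=> x /(derive_psi_supp s0); exact: cubeS.
Qed.

Lemma eta_decrement Omega c r f (g : 'I_n -> 'rV[R]_n -> R) (d : R) :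
  (0 < n)%N -> 0 < r -> 0 < d -> cube c r `<=` Omega ->
  (forall j, weak_partial Omega j f (g j)) ->
  Lp_loc Omega n%:R f -> (forall j, Lp_loc Omega n%:R (g j)) ->
  exists S : R, forall s, S <= s ->
    \int[mu]_x ((f \_ (cube c r)) x * eta c s x) - d <=
    \int[mu]_x ((f \_ (cube c r)) x * eta c (2 * s) x).
Proof.
move=> n0 r0 d0 KO fg fL gL.
have LpK h : Lp_loc Omega n%:R h -> h \_ (cube c r) \in Lfun mu n%:R%:E.
  by apply=> //; exact: compact_cube.
have [M M1 bM] := @bump_bounded R.
have M0 : 0 < M by exact: lt_le_trans M1.
pose C := (2 * M) ^+ n.-1.
have C0 : 0 < C by rewrite exprn_gt0 // mulr_gt0.
(* Chosen so that [n] terms [C * (2 * e)] add up to [d]. *)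
pose e := d / (2 * (C * n%:R)).
have nR0 : 0 < n%:R :> R by rewrite ltr0n.
have e0 : 0 < e by rewrite divr_gt0 // !mulr_gt0.
have H j : exists S : R, 0 < S /\ forall s b, S <= s -> continuous b ->
    (forall x, `|b x| <= C * s ^+ n.-1) ->
    (forall x, b x != 0 -> cube c s^-1 x) ->
    `|\int[mu]_x ((g j \_ (cube c r)) x * b x)| <= C * (2 * e).
  have [S S0 HS] := small_pairing c n0 (ltW C0) e0
    (Lp_integrable n0 (ltW r0) (LpK _ (gL j)))
    (Lp_integrable_exprn n0 (LpK _ (gL j))).
  by exists S.
have [S HS] := choice H.
have S0 j : 0 < S j by have [] := HS j.
(* The sum exceeds every threshold [S j], all being positive; [r^-1] keeps the supports inside the
   fixed cube. *)
exists (r^-1 + \sum_j S j) => s sS.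
have sum0 : 0 <= \sum_j S j by apply: sumr_ge0 => j _; exact: ltW.
have rs : r^-1 <= s by apply: le_trans sS; rewrite lerDl.
have s0 : 0 < s by apply: lt_le_trans rs; rewrite invr_gt0.
have sr : s^-1 <= r by rewrite invf_ple ?posrE.
have := eta_increment s0 sr KO fg (Lp_integrable n0 (ltW r0) (LpK _ fL)).
move/eqP; rewrite subr_eq => /eqP ->; rewrite addrC lerD2r lerN2.
apply: (@le_trans _ _ (\sum_(j < n) C * (2 * e))); last first.
  rewrite sumr_const card_ord /e -mulr_natr le_eqVlt; apply/orP; left.
  by apply/eqP; field; rewrite !gt_eqF.
apply: ler_sum => j _; apply: le_trans (ler_norm _) _.
have [_ ] := HS j; apply.
- apply: le_trans sS; rewrite (bigD1 j) //= addrCA lerDl addr_ge0 ?invr_ge0 ?(ltW r0) //.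
  by apply: sumr_ge0 => i _; exact: ltW.
- exact: continuous_psi.
- move=> x; rewrite (le_trans (psi_le c j x M1 bM s0)) //.
  by rewrite -exprMn mulrAC.
- by move=> x; exact: psi_supp.
Qed.

(** The diagonal of the cube is at most [r] times the square root of [n], rounded up to
    [n%:R * r]. *)
Lemma enorm_cube c x (r : R) : 0 <= r -> cube c r x -> enorm (x - c) <= n%:R * r.
Proof.
move=> r0 cx; rewrite /enorm.
have nr0 : 0 <= n%:R * r by rewrite mulr_ge0.
rewrite -[leRHS]ger0_norm // -sqrtr_sqr ler_wsqrtr //.
apply: (@le_trans _ _ (\sum_(i < n) r ^+ 2)).
  apply: ler_sum => i _; have := cx i; rewrite in_itv /= => /andP[h1 h2].
  rewrite !mxE; rewrite lerXn2r ?nnegrE //; first by rewrite subr_ge0.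
  by rewrite lerBlDl.
rewrite sumr_const card_ord exprMn -[leLHS]mulr_natl ler_wpM2r ?sqr_ge0 //.
by rewrite -natrX ler_nat; case: (n) => // m; rewrite leq_pmulr.
Qed.

Lemma open_cube Omega c : open Omega -> Omega c ->
  exists2 r : R, 0 < r & cube c r `<=` Omega.
Proof.
move=> oO Oc; have /nbhs_ballP[e /= e0 eO] : nbhs c Omega.
  by exact: open_nbhs_nbhs.
(* The cube is closed and the sup-norm ball is open, hence the half. *)
exists (e / 2); first by rewrite divr_gt0.
move=> x cx; apply: eO; split=> // j i; rewrite ord1.
have := cx i; rewrite in_itv /= => /andP[h1 h2].
by rewrite /ball /= ltr_distl; apply/andP; split; lra.
Qed.

End blow_up.

Theorem corollary4p5 (R : realType) (n : nat) (n_ge2 : (2 <= n)%N)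
    (Omega : set 'rV[R]_n) (openOmega : open Omega)
    (phi : 'rV[R]_n -> R) (phiW : W1p_loc Omega n%:R phi)
    (u : 'rV[R]_n -> R) (uLip : lipschitz_fun Omega u)
    (uE : expR \o phi = u %[ae (lebesgue_rV n) in Omega]) :
  forall x, Omega x -> u x != 0.
Proof.
move=> c Oc; apply/eqP => uc0.
have n0 : (0 < n)%N by exact: ltnW.
have [r r0 KO] := open_cube openOmega Oc.
have [f [phif fL fg]] := phiW.
have [g gP] := choice fg.
have [C uC] := uLip.
have fK : f \_ (cube c r) \in Lfun (lebesgue_rV n) n%:R%:E.
  by apply: fL => //; exact: compact_cube.
have iF := Lp_integrable n0 (ltW r0) fK.
have [m m0 bm] := @bump_minorant R.
(* As [u c = 0], the Lipschitz bound and [enorm_cube] give [u <= B / s] on the cube of side [s^-1];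
   adding 1 keeps [B] positive for every [C]. *)
pose B := (`|C| + 1) * n%:R.
have B0 : 0 < B by rewrite mulr_gt0 ?ltr0n // ltr_wpDl.
have ln2 : 0 < ln (2 : R) by rewrite ln_gt0 // ltr1n.
pose L := (m / 4) ^+ n.
have L0 : 0 < L by rewrite exprn_gt0 // divr_gt0.
(* Half of [L * ln 2], the amount by which the upper bound on the averages drops at each doubling of
   the scale. *)
pose d := L * ln 2 / 2.
have d0 : 0 < d by rewrite !mulr_gt0.
have [S HS] := eta_decrement n0 r0 d0 KO (fun j => (gP j).2) fL (fun j => (gP j).1).
(* The condition [B <= s] makes [ln B - ln s] nonpositive, as [Rintegral_eta_le] requires. *)
have up s : 0 < s -> r^-1 <= s -> B <= s ->
    \int[lebesgue_rV n]_x ((f \_ (cube c r)) x * eta c s x) <= (ln B - ln s) * L.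
  move=> s0 rs Bs; have sr : s^-1 <= r by rewrite invf_ple ?posrE.
  apply: Rintegral_eta_le => //.
    by rewrite subr_le0 ler_ln ?posrE.
  (* Off one null set both [phi x = f x] and [expR (phi x) = u x] hold, so there [f x] is the
     logarithm of [u x]. *)
  move: phif uE; apply: filterS2 => x phifx uEx cx.
  have Kx : cube c r x by exact: cubeS cx.
  have Ox := KO _ Kx.
  rewrite patchE mem_set // -(phifx Ox) -(expRK (phi x)).
  rewrite -ln_div ?posrE // ler_ln ?posrE ?expR_gt0 ?divr_gt0 //.
  rewrite -[expR _]/((expR \o phi) x) (uEx Ox).
  have := uC _ _ Oc Ox; rewrite uc0 subr0 => /(le_trans (ler_norm _)) h.
  have sV0 : 0 <= s^-1 by rewrite invr_ge0 ltW.
  have := enorm_cube sV0 cx => he.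
  have hC : C <= `|C| + 1 by rewrite (le_trans (ler_norm C)) // lerDl.
  rewrite (le_trans h) // (le_trans (ler_wpM2r (sqrtr_ge0 _) hC)) //.
  by rewrite /B -mulrA ler_wpM2l // addr_ge0.
(* Above the three thresholds [S], [r^-1] and [B]; the scales [s k] then double from here. *)
pose s0 := `|S| + r^-1 + B.
have rV0 : 0 < r^-1 by rewrite invr_gt0.
have S_ge0 : 0 <= `|S| by [].
have s00 : 0 < s0 by rewrite /s0; lra.
pose s (k : nat) := 2 ^+ k * s0.
have le_s k : s0 <= s k by rewrite ler_peMl ?(ltW s00) // exprn_ege1 // ler1n.
have sgt0 k : 0 < s k by exact: lt_le_trans (le_s k).
apply: (@no_slow_decrease R (fun k => \int[lebesgue_rV n]_x
  ((f \_ (cube c r)) x * eta c (s k) x)) d ((ln B - ln s0) * L) d0) => k.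
  rewrite /s exprS -mulrA; apply: HS; apply: le_trans (le_s k).
  by rewrite (le_trans (ler_norm S)) // /s0; lra.
apply: le_trans (up _ (sgt0 k) _ _) _.
- by apply: le_trans (le_s k); rewrite /s0; lra.
- by apply: le_trans (le_s k); rewrite /s0; lra.
(* Since [ln (s k)] is [k * ln 2 + ln s0], the bound is affine in [k] with slope [- (2 * d)], and
   equality holds. *)
rewrite /s [ln (_ ^+ _ * _)]lnM ?posrE ?exprn_gt0 // lnXn // le_eqVlt /d; apply/orP; left.
by apply/eqP; rewrite -mulr_natl; field.
Qed.
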